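(* For $n\ge 0$ let $C_{2n+1}(132)$ be the set of centrosymmetric permutations of $[2n+1]$ avoiding the pattern $132$, let $r_{n,k}$ be the number of elements of $C_{2n+1}(132)$ with exactly $k$ descents, and let $$R(x,y)=\sum_{n\ge 0}\sum_{\sigma\in C_{2n+1}(132)}x^n y^{\mathrm{des}(\sigma)}=\sum_{n,k\ge0}r_{n,k}x^ny^k .$$ Then $$R(x,y)=\frac{1}{1-x(1+y^2)}.$$ Hence, for every $n\ge 1$, $r_{n,k}=\binom{n}{k/2}$ if $k$ is even and $r_{n,k}=0$ if $k$ is odd.
   Context: A permutation $\sigma$ of $[m]=\{1,\dots,m\}$ is centrosymmetric if $\sigma(i)+\sigma(m+1-i)=m+1$ for all $i$. A permutation $\sigma$ avoids the pattern $132$ if there are no indices $i<j<k$ with $\sigma(i)<\sigma(k)<\sigma(j)$. A descent of $\sigma$ is an index $i$ with $\sigma(i)>\sigma(i+1)$, and $\mathrm{des}(\sigma)$ is the number of descents. *)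

(* Defs.v *)
From HB Require Import structures.
From mathcomp Require Import all_boot all_order all_fingroup all_algebra.
From mathcomp Require Import boolp classical_sets.

Set Implicit Arguments.
Unset Strict Implicit.
Unset Printing Implicit Defensive.

Import GRing.Theory.
Local Open Scope ring_scope.

Record fps (R : Type) : Type := Fps { fcoef : nat -> R }.

Lemma fpsP (R : Type) (f g : fps R) : fcoef f =1 fcoef g -> f = g.
Proof. by case: f g => [f] [g] /= /funext ->. Qed.

HB.instance Definition _ (R : Type) := gen_eqMixin (fps R).
HB.instance Definition _ (R : Type) := gen_choiceMixin (fps R).

Definition fps0 (R : comNzRingType) : fps R := Fps (fun=> 0).
Definition fps1 (R : comNzRingType) : fps R := Fps (fun n => (n == 0)%:R).
Definition fpsX (R : comNzRingType) : fps R := Fps (fun n => (n == 1)%:R).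
Definition fpsC (R : comNzRingType) (c : R) : fps R :=
  Fps (fun n => if n is 0 then c else 0).
Definition fps_opp (R : comNzRingType) (f : fps R) : fps R :=
  Fps (fun n => - fcoef f n).
Definition fps_add (R : comNzRingType) (f g : fps R) : fps R :=
  Fps (fun n => fcoef f n + fcoef g n).
Definition fps_mul (R : comNzRingType) (f g : fps R) : fps R :=
  Fps (fun n => \sum_(i < n.+1) fcoef f i * fcoef g (n - i)).

Lemma fps_addA (R : comNzRingType) : associative (@fps_add R).
Proof. by move=> f g h; apply: fpsP => n /=; rewrite addrA. Qed.

Lemma fps_addC (R : comNzRingType) : commutative (@fps_add R).
Proof. by move=> f g; apply: fpsP => n /=; rewrite addrC. Qed.

Lemma fps_add0 (R : comNzRingType) : left_id (fps0 R) (@fps_add R).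
Proof. by move=> f; apply: fpsP => n /=; rewrite add0r. Qed.

Lemma fps_addN (R : comNzRingType) :
  left_inverse (fps0 R) (@fps_opp R) (@fps_add R).
Proof. by move=> f; apply: fpsP => n /=; rewrite addNr. Qed.

HB.instance Definition _ (R : comNzRingType) :=
  GRing.isZmodule.Build (fps R)
    (@fps_addA R) (@fps_addC R) (@fps_add0 R) (@fps_addN R).

Lemma fcoef_mul_poly (R : comNzRingType) (f g : fps R) (N n : nat) :
  (n < N)%N ->
  fcoef (fps_mul f g) n =
  ((\poly_(i < N) fcoef f i) * (\poly_(i < N) fcoef g i))`_n.
Proof.
move=> nN; rewrite coefM /=; apply: eq_bigr => i _; rewrite !coef_poly.
by rewrite (leq_trans (ltn_ord i) nN) (leq_ltn_trans (leq_subr _ _) nN).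
Qed.

Lemma fps_mulC (R : comNzRingType) : commutative (@fps_mul R).
Proof.
by move=> f g; apply: fpsP => n; rewrite !(fcoef_mul_poly _ _ (ltnSn n)) mulrC.
Qed.

Lemma fps_mulA (R : comNzRingType) : associative (@fps_mul R).
Proof.
move=> f g h; apply: fpsP => n.
rewrite !(fcoef_mul_poly _ _ (ltnSn n)).
set pf := \poly_(i < _) fcoef f i; set ph := \poly_(i < _) fcoef h i.
pose pg := \poly_(i < n.+1) fcoef g i.
have -> : (pf * \poly_(i < n.+1) fcoef (fps_mul g h) i)`_n = (pf * (pg * ph))`_n.
  rewrite !coefM; apply: eq_bigr => i _; congr (_ * _).
  by rewrite coef_poly ltnS leq_subr -fcoef_mul_poly // ltnS leq_subr.
rewrite mulrA !coefM; apply: eq_bigr => i _; congr (_ * _).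
by rewrite coef_poly ltn_ord -fcoef_mul_poly.
Qed.

Lemma fps_mul1 (R : comNzRingType) : left_id (fps1 R) (@fps_mul R).
Proof.
move=> f; apply: fpsP => n /=.
rewrite big_ord_recl /= mul1r subn0 big1 ?addr0 // => i _.
by rewrite /= mul0r.
Qed.

Lemma fps_mulDl (R : comNzRingType) : left_distributive (@fps_mul R) (@fps_add R).
Proof.
move=> f g h; apply: fpsP => n /=; rewrite -big_split.
by apply: eq_bigr => i _; rewrite mulrDl.
Qed.

Lemma fps1_neq0 (R : comNzRingType) : fps1 R != 0.
Proof.
apply/eqP => /(congr1 (fun f => fcoef f 0)) /= /eqP.
by rewrite (negPf (oner_neq0 R)).
Qed.

HB.instance Definition _ (R : comNzRingType) :=
  GRing.Zmodule_isComNzRing.Build (fps R)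
    (@fps_mulA R) (@fps_mulC R) (@fps_mul1 R) (@fps_mulDl R) (@fps1_neq0 R).

(* The inverse of [f] in the ring of power series, chosen classically, with the
   library convention that [f^-1 = f] when [f] has no inverse. *)
Definition fps_unit (R : comNzRingType) : {pred fps R} :=
  fun f => `[< exists g : fps R, g * f = 1 >].
Definition fps_inv (R : comNzRingType) (f : fps R) : fps R :=
  xget f [set g : fps R | g * f = 1]%classic.

Lemma fps_mulVf (R : comNzRingType) :
  {in @fps_unit R, left_inverse 1 (@fps_inv R) *%R}.
Proof. by move=> f /asboolP/(xgetPex f). Qed.

Lemma fps_unitPl (R : comNzRingType) (f g : fps R) : g * f = 1 -> fps_unit f.
Proof. by move=> gf; apply/asboolP; exists g. Qed.

Lemma fps_inv_out (R : comNzRingType) :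
  {in [predC @fps_unit R], @fps_inv R =1 id}.
Proof.
move=> f /asboolPn nf; rewrite /fps_inv.
by case: xgetP => // g _ gf; case: nf; exists g.
Qed.

HB.instance Definition _ (R : comNzRingType) :=
  GRing.ComNzRing_hasMulInverse.Build (fps R)
    (@fps_mulVf R) (@fps_unitPl R) (@fps_inv_out R).

(* Z[[x, y]] as Z[[y]][[x]]: [fcoef (fcoef f n) k] is the coefficient of
   x^n y^k in [f]. *)
Notation fps2 := (fps (fps int)).

Definition x_ : fps2 := fpsX (fps int).
Definition y_ : fps2 := fpsC (fpsX int).

Lemma fcoefXM (R : comNzRingType) (f : fps R) (n : nat) :
  fcoef (fpsX R * f) n = if n is n'.+1 then fcoef f n' else 0.
Proof.
case: n => [|n] /=; first by rewrite big_ord1 mul0r.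
rewrite big_ord_recl mul0r add0r big_ord_recl /= mul1r subn1 /=.
by rewrite big1 ?addr0 // => i _; rewrite mul0r.
Qed.

Lemma fcoefCM (R : comNzRingType) (c : R) (f : fps R) (n : nat) :
  fcoef (fpsC c * f) n = c * fcoef f n.
Proof.
by rewrite /= big_ord_recl /= subn0 big1 ?addr0 // => i _; rewrite mul0r.
Qed.

Lemma fpsC_y : 1 + y_ ^+ 2 = fpsC (1 + fpsX int ^+ 2).
Proof.
apply: fpsP => n; rewrite expr2 /=; case: n => [|n] /=.
  by rewrite big_ord1 /= expr2.
by rewrite -[LHS]/(0 + fcoef (y_ * y_) n.+1) fcoefCM mulr0 addr0.
Qed.

(* So 1 / (1 - x(1 + y^2)) is a genuine inverse, not the default value. *)
Lemma denom_unit : 1 - x_ * (1 + y_ ^+ 2) \is a GRing.unit.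
Proof.
rewrite fpsC_y; set c := 1 + fpsX int ^+ 2.
apply/unitrPr; exists (Fps (fun n => c ^+ n)).
rewrite mulrBl mul1r -mulrA; apply: fpsP => n.
rewrite -[LHS]/(_ - fcoef (x_ * _) n) fcoefXM.
by case: n => [|n]; rewrite ?subr0 // fcoefCM /= -exprS subrr.
Qed.

(* Permutations of [m] are represented on 'I_m = {0, ..., m-1}, positions and
   values being both shifted by one; [rev_ord] is then i |-> m + 1 - i. *)
Definition centrosymmetric (m : nat) (s : 'S_m) : bool :=
  [forall i, ((s i).+1 + (s (rev_ord i)).+1 == m.+1)%N].

Definition avoids132 (m : nat) (s : 'S_m) : bool :=
  ~~ [exists i : 'I_m, exists j : 'I_m, exists k : 'I_m,
        [&& i < j, j < k, s i < s k & s k < s j]%N].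

Definition des (m : nat) (s : 'S_m) : nat :=
  #|[set i : 'I_m | [exists j : 'I_m, (j == i.+1 :> nat) && (s i > s j)%N]]|.

Definition C132 (m : nat) : {set 'S_m} :=
  [set s | centrosymmetric s && avoids132 s].

Definition r_ (n k : nat) : nat := #|[set s in C132 (2 * n).+1 | des s == k]|.

(* The sum over n of x^n c_n with c_n in Z[[y]] is the series of coefficients
   c_n. *)
Definition Rxy : fps2 :=
  Fps (fun n => \sum_(s in C132 (2 * n).+1) fpsX int ^+ des s).

(* Main.v *)
(** Reverse-complementation fixes a centrosymmetric permutation and exchanges
    the patterns 132 and 213, so a centrosymmetric permutation avoiding 132 also
    avoids 213.  In a permutation avoiding both, two positions [i < j] carry
    increasing values iff there is no descent between them; hence the
    permutation is determined by its descent set, and every descent set occurs.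
    Centrosymmetry means that the descent set, a subset of the [2n] gaps between
    consecutive positions, is invariant under reversal.  No gap is fixed by
    reversal, so such a set is an arbitrary subset of the first [n] gaps together
    with its mirror image. *)

Require Import Defs.
From mathcomp Require Import all_boot all_order all_fingroup all_algebra.
From mathcomp Require Import zify.

Set Implicit Arguments.
Unset Strict Implicit.
Unset Printing Implicit Defensive.

Import GRing.Theory.

(** * Permutations and the relative order of their values *)

Lemma card_ord_lt (m : nat) (v : 'I_m) : #|[set k : 'I_m | k < v]| = v.
Proof.
rewrite -sum1dep_card (big_ord_narrow (ltnW (ltn_ord v))).
by rewrite sum1_card card_ord.
Qed.

Lemma perm_rank (m : nat) (s : 'S_m) (i : 'I_m) :
  s i = #|[set j | s j < s i]| :> nat.
Proof.
rewrite -[LHS]card_ord_lt -[LHS](card_preimset _ (@perm_inj _ s)).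
by apply: eq_card => j; rewrite !inE.
Qed.

Lemma perm_eq_order (m : nat) (s t : 'S_m) :
  (forall i j : 'I_m, i < j -> (s i < s j) = (t i < t j)) -> s = t.
Proof.
move=> st; have E i j : (s i < s j) = (t i < t j).
  have [/st//|ji|/val_inj->] := ltngtP i j; last by rewrite !ltnn.
  have neq (p : 'S_m) : p i != p j :> nat.
    by apply/eqP => /val_inj/perm_inj ij; rewrite ij ltnn in ji.
  by have := st _ _ ji; have := neq s; have := neq t; lia.
apply/permP => i; apply: val_inj; rewrite /= perm_rank [RHS]perm_rank.
by apply: eq_card => j; rewrite !inE E.
Qed.

(** Send each index to the rank of its key; ranks increase strictly with the keys, so the map is
    injective. *)
Lemma standardization (m : nat) (K : 'I_m -> nat) :
  injective K -> exists s : 'S_m, forall i j, (s i < s j) = (K i < K j).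
Proof.
move=> Kinj; pose r i := #|[set j | K j < K i]|.
have rm i : r i < m.
  rewrite -[ltnRHS]card_ord -cardsT; apply: proper_card.
  by apply/properP; split; [apply: subsetT|exists i; rewrite !inE ?ltnn].
have mono i j : K i < K j -> r i < r j.
  move=> ij; apply: proper_card; apply/properP; split.
    by apply/subsetP => k; rewrite !inE => ki; apply: ltn_trans ki ij.
  by exists i; rewrite !inE ?ltnn.
have rinj : injective (fun i => Ordinal (rm i)).
  move=> i j [rij]; apply: Kinj.
  by have := mono i j; have := mono j i; lia.
exists (perm rinj) => i j; rewrite !permE /=.
have [/mono->//|ji|/Kinj->] := ltngtP (K i) (K j); last by rewrite ltnn.
by have := mono _ _ ji; lia.
Qed.

(** With [d k] marking a descent between positions [k] and [k.+1], this is the index of the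
    ascending run containing position [i]. *)
Definition prefix_count (d : nat -> bool) (i : nat) := \sum_(0 <= k < i) d k.

Lemma prefix_countS (d : nat -> bool) (i : nat) :
  prefix_count d i.+1 = prefix_count d i + d i.
Proof. by rewrite /prefix_count big_nat_recr. Qed.

Lemma leq_prefix_count (d : nat -> bool) : {homo prefix_count d : i j / i <= j}.
Proof.
move=> i j /subnK<-; elim: (j - i) => // k IH.
by rewrite addSn prefix_countS (leq_trans IH) ?leq_addr.
Qed.

Lemma prefix_count_leq (d : nat -> bool) (i : nat) : prefix_count d i <= i.
Proof.
elim: i => [|i IH]; first by rewrite /prefix_count big_geq.
by rewrite prefix_countS; case: (d i); lia.
Qed.

Lemma eq_prefix_count (d e : nat -> bool) (m i : nat) :
  (forall k, k < m -> d k = e k) -> i <= m ->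
  prefix_count d i = prefix_count e i.
Proof.
move=> de im; apply: eq_big_nat => k /andP[_ ki].
by rewrite de // (leq_trans ki).
Qed.

Lemma prefix_count_sym (d : nat -> bool) (m i : nat) :
  (forall k, k < m -> d (m - k.+1) = d k) -> i <= m ->
  prefix_count d (m - i) + prefix_count d i = prefix_count d m.
Proof.
move=> dsym im; rewrite [RHS]/prefix_count.
rewrite (big_cat_nat (n := m - i)) ?leq_subr //=.
congr (_ + _); rewrite -[m - i]add0n big_addn subKn // big_nat_rev.
apply: eq_big_nat => k /andP[_ ki]; rewrite -dsym; last lia.
by congr (nat_of_bool (d _)); lia.
Qed.

(** * Descents of centrosymmetric 132-avoiders *)

Definition val_at (m : nat) (s : 'S_m.+1) (i : nat) : nat := s (inord i).

Definition descent_at (m : nat) (s : 'S_m.+1) (i : nat) : bool :=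
  val_at s i.+1 < val_at s i.

Lemma val_at_neq (m : nat) (s : 'S_m.+1) (i j : nat) :
  i < j -> j <= m -> val_at s i != val_at s j.
Proof.
move=> ij jm; apply/eqP => /val_inj/perm_inj/(congr1 val) /=.
by rewrite !inordK; lia.
Qed.

Section CentrosymmetricAvoiders.

Variables (m : nat) (s : 'S_m.+1).
Hypothesis sC : s \in C132 m.+1.

Lemma C132_avoids i j k : i < j -> j < k -> k <= m ->
  val_at s i < val_at s k -> val_at s k < val_at s j -> False.
Proof.
move: sC; rewrite inE => /andP[_ /existsPn av] ij jk km ik kj.
move: (av (inord i)) => /existsPn/(_ (inord j))/existsPn/(_ (inord k))/negP.
by apply; rewrite !inordK; rewrite /val_at in ik kj; lia.
Qed.

Lemma C132_sym i : i <= m -> val_at s i + val_at s (m - i) = m.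
Proof.
move: sC; rewrite inE => /andP[/forallP /(_ (inord i))/eqP + _] im.
rewrite /val_at; suff -> : rev_ord (inord i) = inord (m - i) :> 'I_m.+1 by lia.
by apply: val_inj; rewrite /= !inordK; lia.
Qed.

(* Reversing and complementing turns 132 into 213. *)
Lemma C132_avoids213 i j k : i < j -> j < k -> k <= m ->
  val_at s j < val_at s i -> val_at s i < val_at s k -> False.
Proof.
move=> ij jk km ji ik.
have := @C132_avoids (m - k) (m - j) (m - i).
have := @C132_sym i; have := @C132_sym j; have := @C132_sym k; lia.
Qed.

(** Induction on [j - i]. If gap [i] is an ascent, avoiding 132 keeps the value at [j] out of the
    interval between the values at [i] and [i.+1], so [i] may be replaced by [i.+1]. If it is a
    descent, avoiding 213 puts the value at [j] below that at [i], and the counts differ. *)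
Lemma C132_lt i j : i < j -> j <= m ->
  (val_at s i < val_at s j) =
  (prefix_count (descent_at s) i == prefix_count (descent_at s) j).
Proof.
move=> + jm; have [k jE] : exists k, k = j - i by exists (j - i).
elim: k i jE => [|k IH] i jE ij; first lia.
have dE : descent_at s i = (val_at s i.+1 < val_at s i) by [].
have [j_eq|i1j] : j = i.+1 \/ i.+1 < j by lia.
  by have := val_at_neq s ij jm; rewrite j_eq prefix_countS; lia.
have := IH i.+1; rewrite prefix_countS.
have := leq_prefix_count (descent_at s) (ltnW i1j); rewrite prefix_countS.
have := @C132_avoids i i.+1 j; have := @C132_avoids213 i i.+1 j.
have := @val_at_neq _ s i i.+1; have := val_at_neq s ij jm.
have := val_at_neq s i1j jm; lia.
Qed.

Lemma descent_at_sym i : i < m -> descent_at s (m - i.+1) = descent_at s i.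
Proof.
move=> im; rewrite /descent_at.
have := @C132_sym i; have := @C132_sym i.+1.
have -> : (m - i.+1).+1 = m - i by lia.
lia.
Qed.

End CentrosymmetricAvoiders.

Lemma desE (m : nat) (s : 'S_m.+1) : des s = prefix_count (descent_at s) m.
Proof.
rewrite /des -sum1dep_card big_mkcond /prefix_count big_mkord.
(* The last position has no successor, so its term vanishes. *)
rewrite big_ord_recr /= [X in _ + X]ifF ?addn0; last first.
  by apply/negbTE/existsPn => j; have := ltn_ord j; lia.
apply: eq_bigr => i _.
suff -> : [exists j : 'I_m.+1, (j == i.+1 :> nat) &&
  (s j < s (widen_ord (leqnSn m) i))] = descent_at s i by case: descent_at.
have iE : widen_ord (leqnSn m) i = inord i.
  by apply: val_inj; rewrite /= inordK // ltnS ltnW.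
rewrite iE /descent_at /val_at; apply/existsP/idP => [[j /andP[/eqP <-]]|lt].
  by rewrite inord_val.
by exists (inord i.+1); rewrite lt andbT inordK // ltnS.
Qed.

(** * Bijection with the subsets of the first [n] gaps *)

Section FirstHalf.

Variable n : nat.

Definition half_descents (s : 'S_(2 * n).+1) : {set 'I_n} :=
  [set a : 'I_n | descent_at s a].

Lemma des_half (s : 'S_(2 * n).+1) :
  s \in C132 (2 * n).+1 -> des s = 2 * #|half_descents s|.
Proof.
move=> sC; rewrite desE.
(* At the centre [n] the two counts of the symmetry identity coincide. *)
rewrite -(@prefix_count_sym _ _ n (descent_at_sym sC)); last lia.
have -> : 2 * n - n = n by lia.
rewrite addnn -mul2n; congr (_ * _).
rewrite /prefix_count big_mkord -sum1dep_card [RHS]big_mkcond.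
by apply: eq_bigr => i _; case: descent_at.
Qed.

Lemma half_descents_inj : {in C132 (2 * n).+1 &, injective half_descents}.
Proof.
move=> s t sC tC /setP st.
have lo k : k < n -> descent_at s k = descent_at t k.
  by move=> kn; have := st (Ordinal kn); rewrite !inE.
have E k : k < 2 * n -> descent_at s k = descent_at t k.
  move=> kn; have [/lo//|nk] := ltnP k n.
  by rewrite -(descent_at_sym sC) // -(descent_at_sym tC) // lo //; lia.
apply: perm_eq_order => i j ij; have jn : j <= 2 * n by rewrite -ltnS.
have := C132_lt sC ij jn; have := C132_lt tC ij jn.
rewrite /val_at !inord_val => -> ->.
by rewrite !(eq_prefix_count E) //; apply: leq_trans (ltnW ij) jn.
Qed.

(** Gaps are numbered from 0, so the mirror image of gap [a] is [2 * n - a.+1]. *)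
Definition mirror (A : {set 'I_n}) (i : nat) : bool :=
  [exists a in A, (i == a) || (i + a.+1 == 2 * n)].

Lemma mirror_sym A k : k < 2 * n -> mirror A (2 * n - k.+1) = mirror A k.
Proof.
move=> kn; apply: eq_existsb => a; congr (_ && _).
by have := ltn_ord a; lia.
Qed.

Lemma mirrorE A (a : 'I_n) : mirror A a = (a \in A).
Proof.
apply/existsP/idP => [[b /andP[bA /orP[/eqP/val_inj->//|]]]|aA].
  by have := ltn_ord a; have := ltn_ord b; lia.
by exists a; rewrite aA eqxx.
Qed.

(* Sorting the positions by decreasing prefix count, then increasing position,
   makes every maximal ascending run an interval of values lying above all the
   following runs. *)
Lemma half_descents_surj A :
  exists2 s : 'S_(2 * n).+1, s \in C132 (2 * n).+1 & half_descents s = A.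
Proof.
pose c := prefix_count (mirror A).
(* The factor exceeds every position, so keys compare lexicographically and [i] is the key modulo
   [(2 * n).+1]. *)
pose K (i : 'I_(2 * n).+1) := i + (2 * n - c i) * (2 * n).+1.
have Kord (i j : 'I_(2 * n).+1) : i < j -> (K i < K j) = (c i == c j).
  move=> ij; rewrite /K; have := leq_prefix_count (mirror A) (ltnW ij).
  rewrite -/(c i) -/(c j); have := ltn_ord i; have := ltn_ord j.
  have : c i <= i by apply: prefix_count_leq.
  have : c j <= j by apply: prefix_count_leq.
  by case: (eqVneq (c i) (c j)) => [->|]; nia.
have Kinj : injective K.
  move=> i j /(congr1 (modn^~ (2 * n).+1)).
  by rewrite /K ![_ + _ * _]addnC !modnMDl !modn_small // => /val_inj.
have [s sK] := standardization Kinj.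
have sc (i j : 'I_(2 * n).+1) : i < j -> (s i < s j) = (c i == c j).
  by move=> ij; rewrite sK Kord.
have sC : s \in C132 (2 * n).+1.
  rewrite inE; apply/andP; split.
    (* [f] is the reverse-complement of [s]. It orders positions as [s] does because
       [c (2 * n - i) + c i] is constant, so both are equal. *)
    pose f i := rev_ord (s (rev_ord i)).
    have finj : injective f by move=> i j /rev_ord_inj/perm_inj/rev_ord_inj.
    have sE : s = perm finj.
      apply: perm_eq_order => i j ij; rewrite !permE /f /= sc //.
      have := ltn_ord (s (rev_ord i)); have := ltn_ord (s (rev_ord j)).
      have /= := @sc (rev_ord j) (rev_ord i); rewrite !subSS.
      have := @prefix_count_sym _ _ i (@mirror_sym A).
      have := @prefix_count_sym _ _ j (@mirror_sym A).
      rewrite -/c; have := ltn_ord i; have := ltn_ord j; lia.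
    apply/forallP => i; have : s i = f i by rewrite {1}sE permE.
    move/(congr1 val) => /= ->; have := ltn_ord (s (rev_ord i)); lia.
  (* In a 132 pattern the outer positions have equal [c]. By monotonicity the middle one shares it,
     so the last two values would increase. *)
  apply/existsPn => i; apply/existsPn => j; apply/existsPn => k.
  apply/negP => /and4P[ij jk]; rewrite sc ?(ltn_trans ij) // => ik kj.
  have := sc _ _ jk; have := leq_prefix_count (mirror A) (ltnW ij).
  have := leq_prefix_count (mirror A) (ltnW jk); rewrite -!/(c _); lia.
exists s => //; apply/setP => a; rewrite inE -mirrorE /descent_at.
have an := ltn_ord a.
have := @sc (inord a) (inord a.+1); rewrite !inordK; try lia.
have := @val_at_neq _ s a a.+1; rewrite /val_at /c prefix_countS.
by case: mirror; lia.
Qed.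

Lemma half_descents_imset :
  half_descents @: C132 (2 * n).+1 = [set: {set 'I_n}].
Proof.
apply/setP => A; rewrite inE; apply/imsetP.
by have [s sC <-] := half_descents_surj A; exists s.
Qed.

(** Stated for any commutative monoid so as to serve both the counting of [r_] and the sum of powers
    in [Rxy]. *)
Lemma big_C132 (T : Type) (idx : T) (op : Monoid.com_law idx) (F : nat -> T) :
  \big[op/idx]_(s in C132 (2 * n).+1) F (des s) =
  \big[op/idx]_(A : {set 'I_n}) F (2 * #|A|).
Proof.
transitivity (\big[op/idx]_(A in [set: {set 'I_n}]) F (2 * #|A|)).
  rewrite -half_descents_imset big_imset; last exact: half_descents_inj.
  by apply: eq_bigr => s /des_half ->.
by apply: eq_bigl => A; rewrite inE.
Qed.

Lemma r_E k : r_ n k = if odd k then 0 else 'C(n, k./2).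
Proof.
rewrite /r_ -sum1dep_card big_mkcondr /=.
rewrite (@big_C132 _ _ _ (fun d => if d == k then 1 else 0)) -big_mkcond /=.
rewrite sum1dep_card; case: ifP => [ok|ek].
  by apply/eqP; rewrite cards_eq0; apply/eqP/setP => A; rewrite !inE; lia.
rewrite -[X in 'C(X, _)]card_ord -card_draws.
by apply: eq_card => A; rewrite !inE; set c := #|A|; rewrite -/c; lia.
Qed.

End FirstHalf.

(** * The generating function *)

Local Open Scope ring_scope.

Lemma fcoef_sum (R : comNzRingType) (I : Type) (r : seq I) (P : pred I)
    (F : I -> fps R) (k : nat) :
  fcoef (\sum_(i <- r | P i) F i) k = \sum_(i <- r | P i) fcoef (F i) k.
Proof. exact: (big_morph (fun f : fps R => fcoef f k)). Qed.

Lemma fcoefXn (R : comNzRingType) (d k : nat) :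
  fcoef (fpsX R ^+ d) k = (d == k)%:R.
Proof.
elim: d k => [|d IH] k; first by rewrite expr0 eq_sym.
by rewrite exprS fcoefXM; case: k => [|k]; rewrite ?IH.
Qed.

(** Expand the product of [n] factors [z + 1]: [A] collects the factors from which [z] is chosen. *)
Lemma sum_exp_card (R : comNzRingType) (n : nat) (z : R) :
  \sum_(A : {set 'I_n}) z ^+ #|A| = (1 + z) ^+ n.
Proof.
rewrite addrC -[n in RHS]card_ord -prodr_const bigA_distr.
apply: eq_big => [A|A _]; first by apply/esym/subsetP.
by rewrite -big_mkcond prodr_const.
Qed.

Lemma fcoef_Rxy (n : nat) : fcoef Rxy n = (1 + fpsX int ^+ 2) ^+ n.
Proof.
rewrite /= (@big_C132 n _ _ _ (fun d => fpsX int ^+ d)).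
by under eq_bigr => A _ do rewrite exprM; rewrite sum_exp_card.
Qed.

Lemma Rxy_mul : Rxy * (1 - x_ * (1 + y_ ^+ 2)) = 1.
Proof.
rewrite mulrC fpsC_y mulrBl mul1r -mulrA; apply: fpsP => n.
rewrite -[LHS]/(fcoef Rxy n - fcoef (x_ * _) n) fcoefXM fcoef_Rxy.
(* The coefficients of [Rxy] are geometric, so all but the constant one cancel. *)
by case: n => [|n]; rewrite ?subr0 // fcoefCM fcoef_Rxy -exprS subrr.
Qed.

Theorem theorem2 :
  [/\ Rxy = Fps (fun n => Fps (fun k => (r_ n k)%:Z)),
      Rxy = 1 / (1 - x_ * (1 + y_ ^+ 2)) &
      forall n k : nat, (1 <= n)%N ->
        r_ n k = if odd k then 0%N else 'C(n, k./2)].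
Proof.
split; last by move=> n k _; apply: r_E.
  apply: fpsP => n; apply: fpsP => k; rewrite /= fcoef_sum /r_ -sum1dep_card.
  rewrite -natz natr_sum big_mkcondr; apply: eq_bigr => s _.
  by rewrite fcoefXn; case: eqP.
by rewrite -[LHS](mulrK denom_unit) Rxy_mul.
Qed.
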